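(* Let $n\ge1$, $\eta>0$. Let $\Pi$ be a probability distribution on $\mathcal F$ (not depending on data) with density $\pi$ relative to a measure $\rho$ on $\mathcal F$, and let $\hat\Pi$ be a randomized estimator such that for every $z^n\in\mathcal Z^n$, $\hat\Pi\mid z^n$ has a density $\hat\pi(\cdot\mid z^n)$ relative to $\rho$. Set $w(z^n,f):=\pi(f)/\hat\pi(f\mid z^n)$. Then $$S_\eta(\mathcal F,\hat\Pi,w)\le1 .$$ Consequently, for all $z^n\in\mathcal Z^n$, $$\mathrm{COMP}^{\mathrm{full}}_\eta(\mathcal F,\hat\Pi,w,z^n)\le\mathbb E_{f\sim\hat\Pi\mid z^n}[R_f(z^n)]+\eta^{-1}\,\mathrm{KL}\big((\hat\Pi\mid z^n)\,\|\,\Pi\big),$$ where $\mathrm{KL}((\hat\Pi\mid z^n)\,\|\,\Pi)=\mathbb E_{f\sim\hat\Pi\mid z^n}[\log(\hat\pi(f\mid z^n)/\pi(f))]$.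
   Context: $Z_1,\dots,Z_n$ are i.i.d. from a probability distribution $P$ on $\mathcal Z$; $Z^n\sim P$ means i.i.d. sampling. $\mathcal F$ is a model (a measurable space of predictors), $\ell_f(z)\in\mathbb R$ the loss of $f\in\mathcal F$ on $z$, $f^*\in\mathcal F$ a minimizer of $\mathbb E_{Z\sim P}[\ell_f(Z)]$ over $\mathcal F$ (assumed to exist). $R_f(z)=\ell_f(z)-\ell_{f^*}(z)$ and $R_f(z^n)=\sum_{i=1}^nR_f(z_i)$. All functions are assumed measurable, and the expectations and normalizers below are assumed well-defined and finite as needed. A randomized estimator $\hat\Pi$ maps each $z^n\in\mathcal Z^n$ to a probability distribution $\hat\Pi\mid z^n$ on $\mathcal F$. For a function $w:\mathcal Z^n\times\mathcal F\to[0,\infty)$ and $\eta>0$: - $C(f)=\mathbb E_{Z^n\sim P}[e^{-\eta R_f(Z^n)}]$; - $S_\eta(\mathcal F,\hat\Pi,w)=\mathbb E_{Z^n\sim P}\big[\exp\big(-\mathbb E_{f\sim\hat\Pi\mid Z^n}[\eta R_f(Z^n)+\log C(f)-\log w(Z^n,f)]\big)\big]$; - $\mathrm{COMP}_\eta(\mathcal F,\hat\Pi,w,z^n)=\frac1\eta\big(\mathbb E_{f\sim\hat\Pi\mid z^n}[-\log w(z^n,f)]+\log S_\eta(\mathcal F,\hat\Pi,w)\big)$; - $\mathrm{COMP}^{\mathrm{full}}_\eta(\mathcal F,\hat\Pi,w,z^n)=\mathrm{COMP}_\eta(\mathcal F,\hat\Pi,w,z^n)+\mathbb E_{f\sim\hat\Pi\mid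 z^n}[R_f(z^n)]$. *)

(* Defs.v *)
(* MathComp-Analysis. *)
From HB Require Import structures.
From mathcomp Require Import all_boot all_order all_algebra.
From mathcomp Require Import all_classical all_reals all_analysis.
Set Implicit Arguments.
Unset Strict Implicit.
Unset Printing Implicit Defensive.
Import Order.TTheory GRing.Theory Num.Theory.
Import numFieldNormedType.Exports.
Local Open Scope classical_set_scope.
Local Open Scope ring_scope.
Local Open Scope ereal_scope.

Section iid_law.
Context (d : measure_display) (T : measurableType d) (R : realType).

Definition cons_pair (n : nat) (x : T * n.-tuple T) : n.+1.-tuple T :=
  [the n.+1.-tuple T of x.1 :: x.2].

Lemma measurable_cons_pair n : measurable_fun setT (@cons_pair n).
Proof. exact: (measurable_cons measurable_fst measurable_snd). Qed.

HB.instance Definition _ n :=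
  isMeasurableFun.Build _ _ _ _ (@cons_pair n) (@measurable_cons_pair n).

(* The n-fold product measure, by recursion on n through the binary product;
   iid_law_box characterizes it by its values on boxes. *)
Fixpoint iid_law (P : probability T R) (n : nat) : probability (n.-tuple T) R :=
  match n with
  | 0%N => \d_([tuple] : 0.-tuple T)
  | m.+1 => distribution (P \x iid_law P m) (@cons_pair m)
  end.

Lemma iid_law_box (P : probability T R) n (A : 'I_n -> set T) :
  (forall i, measurable (A i)) ->
  iid_law P n [set z | forall i, A i (tnth z i)] = \prod_(i < n) P (A i).
Proof.
elim: n A => [|n IH] A mA.
  rewrite big_ord0 /= diracE mem_set//=.
  by case.
rewrite big_ord_recl /= /distribution /pushforward.
have -> : cons_pair (n:=n) @^-1` [set z | forall i, A i (tnth z i)] =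
    A ord0 `*` [set z | forall i, A (lift ord0 i) (tnth z i)].
  apply/seteqP; split => -[x z] /=.
    move=> h; split; first exact: (h ord0).
    by move=> i; have := h (lift ord0 i); rewrite /cons_pair tnthS.
  move=> [h0 hS] i; case: (unliftP ord0 i) => [j ->|->]; last by [].
  by rewrite /cons_pair tnthS; exact: hS.
rewrite product_measure1E//.
  by congr (_ * _); exact: (IH (fun i => A (lift ord0 i))).
have -> : [set z | forall i, A (lift ord0 i) (tnth z i)] =
    \bigcap_(i in [set: 'I_n]) ((fun z : n.-tuple T => tnth z i) @^-1`
                                 A (lift ord0 i)).
  by apply/seteqP; split => z /= h i => [_|]; exact: h.
apply: fin_bigcap_measurable => // i _.
by rewrite -[X in measurable X]setTI; exact: measurable_tnth.
Qed.

End iid_law.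

Section complexity.
Context (dZ dF : measure_display) (Z : measurableType dZ)
        (F : measurableType dF) (R : realType).
Implicit Types (P : probability Z R) (l : F -> Z -> R) (fs : F) (eta : R).

(* The risks may take the values +oo and -oo, but not the form oo - oo. *)
Definition risk_minimizer P l fs : Prop :=
  (forall f, \int[P]_z ((EFin \o l f)^\+ z) < +oo \/
             \int[P]_z ((EFin \o l f)^\- z) < +oo) /\
  (forall f, \int[P]_z (l fs z)%:E <= \int[P]_z (l f z)%:E).

Definition excess l fs (f : F) (z : Z) : R := (l f z - l fs z)%R.

Definition excess_sum l fs (n : nat) (f : F) (zn : n.-tuple Z) : R :=
  (\sum_(i < n) excess l fs f (tnth zn i))%R.

Definition normalizer P l fs eta (n : nat) (f : F) : \bar R :=
  \int[iid_law P n]_zn (expR (- eta * excess_sum l fs f zn))%:E.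

(* Logarithms and exponentials are extended to \bar R: lne 0 = -oo, so that
   - log w = +oo where w vanishes, and expeR -oo = 0. Every expectation takes
   its value in \bar R; the form oo - oo evaluates to -oo, both in the integral
   of a function with infinite positive and negative parts and in a sum. *)
Definition S_eta P l fs eta (n : nat)
    (Pihat : R.-pker (n.-tuple Z) ~> F) (w : n.-tuple Z -> F -> R) : \bar R :=
  \int[iid_law P n]_zn
    expeR (- \int[Pihat zn]_f ((eta * excess_sum l fs f zn)%:E
                               + lne (normalizer P l fs eta n f)
                               - lne (w zn f)%:E)).

Definition COMP P l fs eta (n : nat)
    (Pihat : R.-pker (n.-tuple Z) ~> F) (w : n.-tuple Z -> F -> R)
    (zn : n.-tuple Z) : \bar R :=
  (eta^-1)%:E * (\int[Pihat zn]_f (- lne (w zn f)%:E)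
                 + lne (S_eta P l fs eta Pihat w)).

Definition COMP_full P l fs eta (n : nat)
    (Pihat : R.-pker (n.-tuple Z) ~> F) (w : n.-tuple Z -> F -> R)
    (zn : n.-tuple Z) : \bar R :=
  COMP P l fs eta Pihat w zn
  + \int[Pihat zn]_f (excess_sum l fs f zn)%:E.

Definition has_density (rho mu : {measure set F -> \bar R}) (g : F -> R) : Prop :=
  [/\ measurable_fun setT g, (forall f, (0 <= g f)%R) &
      forall A, measurable A -> mu A = \int[rho]_(f in A) (g f)%:E].

(* KL(mu || nu), where q and p are the densities of mu and nu. The quotient is
   taken in \bar R, where q / 0 = +oo for q > 0; points with q = 0 are mu-null. *)
Definition KL (mu : {measure set F -> \bar R}) (q p : F -> R) : \bar R :=
  \int[mu]_f lne ((q f)%:E / (p f)%:E).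

End complexity.

(* Main.v *)
(* Write [k z f] for the integrand [eta R_f(z) + log C(f) - log w(z, f)]. By
   Jensen, [exp (- E_f k)] is at most [E_f exp (- k)], the expectation being
   under the randomized estimator. In the latter the density of the estimator
   cancels against the denominator of [w], which leaves at most the expectation
   of [exp (- eta R_f(z)) / C(f)] under the data-independent [Pi]; by Tonelli
   its average over the sample is at most 1. Finally, [E_f (- log w)] is the
   KL divergence, and [log S] is nonpositive. *)
Require Import Defs.
From mathcomp Require Import all_boot all_order all_algebra.
From mathcomp Require Import all_classical all_reals all_analysis.
From mathcomp Require Import measurable_realfun.
Set Implicit Arguments.
Unset Strict Implicit.
Unset Printing Implicit Defensive.
Import Order.TTheory GRing.Theory Num.Theory.
Import HBNNSimple.
Import numFieldNormedType.Exports.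
Local Open Scope classical_set_scope.
Local Open Scope ring_scope.
Local Open Scope ereal_scope.

(** * Measurability of the extended exponential and logarithm and of the inverse *)

Lemma measurable_expeR (R : realType) : measurable_fun [set: \bar R] expeR.
Proof.
rewrite (_ : expeR = fun x : \bar R => if x == +oo then +oo else
    if x == -oo then 0 else (expR (fine x))%:E); last first.
  by apply/funext => -[r||].
apply: measurable_fun_ifT => //; first exact: measurable_fun_eqe.
apply: measurable_fun_ifT => //; first exact: measurable_fun_eqe.
apply/measurable_EFinP.
exact: (measurableT_comp (@measurable_expR R) (fine_measurable measurableT)).
Qed.

Lemma measurable_lne (R : realType) : measurable_fun [set: \bar R] (@lne R).
Proof.
rewrite (_ : @lne R = fun x : \bar R => if x == +oo then +oo else
    if x <= 0 then -oo else (ln (fine x))%:E); last first.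
  apply/funext => -[r||] //=; by rewrite leNye.
apply: measurable_fun_ifT => //; first exact: measurable_fun_eqe.
apply: measurable_fun_ifT => //; first exact: measurable_fun_lee.
apply/measurable_EFinP.
exact: (measurableT_comp (@measurable_ln R) (fine_measurable measurableT)).
Qed.

(** On nonnegative reals the inverse is the power of exponent -1, even at 0, where both are 0. *)
Lemma measurable_fun_invr_ge0 d (T : measurableType d) (R : realType)
    (f : T -> R) : (forall x, (0 <= f x)%R) -> measurable_fun [set: T] f ->
  measurable_fun [set: T] (fun x => (f x)^-1%R).
Proof.
move=> f0 mf; under eq_fun do rewrite -powR_inv1//.
exact: (@measurableT_comp _ _ _ _ _ _ (@powR R ^~ (-1)%R)).
Qed.

(** * Integration against densities and Jensen's inequality *)

(** For indicators this is the definition of a density; linearity gives simple functions, and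
    monotone convergence along [s] gives [h]. *)
Lemma has_density_ge0_integral d (T : measurableType d) (R : realType)
    (rho mu : {measure set T -> \bar R}) (g : T -> R) (h : T -> \bar R) :
  has_density rho mu g -> measurable_fun [set: T] h -> (forall x, 0 <= h x) ->
  \int[mu]_x h x = \int[rho]_x ((g x)%:E * h x).
Proof.
move=> [mg g0 muE] mh h0.
pose s := nnsfun_approx measurableT mh.
have mge : measurable_fun [set: T] (EFin \o g) by exact/measurable_EFinP.
have ms n : measurable_fun [set: T] (fun x => (s n x)%:E) by exact/measurable_EFinP.
have hE x : h x = limn (fun n => (s n x)%:E).
  by apply/esym/cvg_lim => //; exact: cvg_nnsfun_approx.
under eq_integral do rewrite hE.
have -> : \int[mu]_x limn (fun n => (s n x)%:E) =
    limn (fun n => \int[mu]_x (s n x)%:E).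
  apply: monotone_convergence => // [n x _|x _ a b ab].
    by rewrite lee_fin.
  by rewrite lee_fin; exact/lefP/nd_nnsfun_approx.
have -> : \int[rho]_x ((g x)%:E * h x) =
    limn (fun n => \int[rho]_x ((g x)%:E * (s n x)%:E)).
  rewrite -monotone_convergence//.
  - apply: eq_integral => x _; apply/esym/cvg_lim => //.
    by apply: cvgeZl => //; exact: cvg_nnsfun_approx.
  - by move=> n; exact: emeasurable_funM.
  - by move=> n x _; rewrite mule_ge0 ?lee_fin.
  - move=> x _ a b ab; rewrite lee_wpmul2l ?lee_fin//.
    exact/lefP/nd_nnsfun_approx.
congr (limn _); apply/funext => n.
have mi y : measurable (s n @^-1` [set y]) by exact: measurable_funPTI.
have my y : measurable_fun [set: T]
    (fun x => (y * \1_(s n @^-1` [set y]) x)%:E).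
  by apply/measurable_EFinP; exact: measurable_funM.
transitivity (\sum_(y \in range (s n))
    \int[mu]_x (y * \1_(s n @^-1` [set y]) x)%:E).
  rewrite -ge0_integral_fsum//; last first.
    by move=> y x _; exact: nnfun_muleindic_ge0.
  by apply: eq_integral => x _; rewrite /= fimfunE -fsumEFin.
transitivity (\sum_(y \in range (s n))
    \int[rho]_x ((g x)%:E * (y * \1_(s n @^-1` [set y]) x)%:E)); last first.
  rewrite -ge0_integral_fsum//.
  - apply: eq_integral => x _; rewrite -ge0_mule_fsumr//; last first.
      by move=> y; exact: nnfun_muleindic_ge0.
    by rewrite fsumEFin// -fimfunE.
  - by move=> y; exact: emeasurable_funM.
  - move=> y x _; rewrite mule_ge0 ?lee_fin//.
    by rewrite -lee_fin; exact: nnfun_muleindic_ge0.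
(* Only values [y = s n x] that are attained occur, so the scalar is nonnegative and can be pulled
   out of both integrals. *)
apply: eq_fsbigr => y /[!inE] -[x _ <-].
under eq_integral do rewrite EFinM.
rewrite ge0_integralZl ?lee_fin//; last by exact/measurable_EFinP.
under [RHS]eq_integral do rewrite EFinM muleCA.
rewrite ge0_integralZl ?lee_fin//; last 2 first.
- by apply: emeasurable_funM => //; exact/measurable_EFinP.
- by move=> t _; rewrite mule_ge0 ?lee_fin.
rewrite integral_indic// setIT muE//; congr (_ * _).
rewrite integral_mkcond; apply: eq_integral => t _.
by rewrite patchE indicE; case: ifPn => _; rewrite ?mule1 ?mule0.
Qed.

(* The tangent line of the exponential at [m := - \int k] gives
   [expeR m * (1 - k x - m) <= expeR (- k x)]. When the right-hand side is
   finite it dominates the negative part of [k], so [\int k] never has the form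
   oo - oo. *)
Lemma expeR_integral_le d (T : measurableType d) (R : realType)
    (mu : {measure set T -> \bar R}) (k : T -> \bar R) : mu [set: T] = 1 ->
  measurable_fun [set: T] k ->
  expeR (- \int[mu]_x k x) <= \int[mu]_x expeR (- k x).
Proof.
move=> mu1 mk.
have mNk : measurable_fun [set: T] (fun x => - k x) by exact: measurableT_comp.
have mek : measurable_fun [set: T] (fun x => expeR (- k x)).
  exact: (measurableT_comp (@measurable_expeR R) mNk).
have ek0 x : 0 <= expeR (- k x) by exact: expeR_ge0.
have [->|ekoo] := eqVneq (\int[mu]_x expeR (- k x)) +oo; first by rewrite leey.
have iek : mu.-integrable [set: T] (fun x => expeR (- k x)).
  apply/integrableP; split => //.
  by under eq_integral do rewrite gee0_abs//; rewrite ltey.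
have knoo : \int[mu]_x k^\- x < +oo.
  rewrite (@le_lt_trans _ _ (\int[mu]_x expeR (- k x)))// ?ltey//.
  apply: ge0_le_integral => //; first exact: measurable_funeneg.
  move=> x _; rewrite funenegE ge_max expeR_ge0 andbT.
  by rewrite (le_trans _ (expeR_ge1Dx _))// leeDr.
have kn_fin : \int[mu]_x k^\- x \is a fin_num.
  by rewrite ge0_fin_numE// integral_ge0.
(* If the positive part has infinite integral, then [\int k = +oo], the negative part being finite,
   and the left-hand side is [expeR -oo = 0]. *)
have [kpoo|kpoo] := eqVneq (\int[mu]_x k^\+ x) +oo.
  rewrite integralE kpoo addye//; last first.
    by rewrite eqe_oppLR/= (andP (eqbLR (fin_numE _) kn_fin)).2.
  by rewrite integral_ge0.
have ik : mu.-integrable [set: T] k.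
  apply/integrableP; split => //.
  under eq_integral do rewrite -/((abse \o k) _) fune_abse.
  rewrite ge0_integralD//; last 2 first.
    exact: measurable_funepos.
    exact: measurable_funeneg.
  by rewrite lte_add_pinfty// ltey.
have := integrable_fin_num measurableT ik.
set m := \int[mu]_x k x => mfin.
have icst c : mu.-integrable [set: T] (cst c%:E).
  apply/integrableP; split => //=.
  by rewrite integral_cst// mu1 mule1 ltry.
have im : mu.-integrable [set: T] (cst m) by rewrite -(fineK mfin).
have imk : mu.-integrable [set: T] (fun x => m - k x).
  exact: integrableB.
(* In this branch [m] is [\int k] itself and is finite. After multiplication by [expeR m] the
   tangent bound reads [1 + (m - k x) <= expeR (m - k x)], and its left side integrates to 1. *)
suff : 1 <= \int[mu]_x expeR (- k x) * expeR m.
  rewrite -(fineK mfin) => h.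
  by rewrite -EFinN /= expRN -[leLHS]mul1e lee_pdivrMr// expR_gt0.
have -> : 1 = \int[mu]_x (1 + (m - k x)).
  rewrite integralD//; last exact: (icst 1%R).
  rewrite integralB// -/m !integral_cst//= mu1 !mule1.
  by rewrite subee// adde0.
rewrite -ge0_integralZr ?expeR_ge0//.
apply: le_integral => //; first exact: integrableD (icst 1%R) _.
  by under eq_fun do rewrite muleC; rewrite -(fineK mfin)/=; exact: integrableZl.
by move=> x _; rewrite -expeRD addeC (addeC (- _)) addeC; exact: expeR_ge1Dx.
Qed.

(** The [mu]-measure of the zero set of [g] is the integral of [g] over that set, hence 0. *)
Lemma has_density_zero_negligible d (T : measurableType d) (R : realType)
    (rho mu : {measure set T -> \bar R}) (g : T -> R) :
  has_density rho mu g -> {ae mu, forall x, g x != 0%R}.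
Proof.
move=> [mg g0 muE].
have mg0 : measurable [set x | g x = 0%R].
  by rewrite -[X in measurable X]setTI; exact: (mg measurableT _ (measurable_set1 _)).
exists [set x | g x = 0%R]; split => //=; last first.
  by move=> x /= /negP; rewrite negbK => /eqP.
by rewrite muE// integral0_eq// => x /= ->.
Qed.

(** A zero integral would force [f = 0] almost everywhere, making the whole space null against its
    mass 1. *)
Lemma integral_gt0 d (T : measurableType d) (R : realType)
    (mu : probability T R) (f : T -> \bar R) : measurable_fun [set: T] f ->
  (forall x, 0 < f x) -> 0 < \int[mu]_x f x.
Proof.
move=> mf f0; rewrite lt0e integral_ge0 ?andbT => [|x _]; last exact: ltW.
apply/eqP => int0.
have /(ae_eq_integral_abs mu measurableT mf) : \int[mu]_x `|f x| = 0.
  by under eq_integral do rewrite gee0_abs ?ltW//.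
move=> [N [mN N0 sub]].
have NT : N = [set: T].
  apply/seteqP; split => // x _; apply: sub => /= /(_ I) fx0.
  by have := f0 x; rewrite fx0 ltxx.
by have := @probability_setT _ _ _ mu; rewrite -NT N0 => /eqP; rewrite eq_sym onee_eq0.
Qed.

Lemma expeR_lneK_EFin (R : realType) (x : R) : (0 <= x)%R ->
  expeR (lne x%:E) = x%:E.
Proof. by move=> x0; apply/eqP; rewrite lneK_eq lee_fin. Qed.

(** * Excess risk and its exponential normalizer *)

Section excess_risk.
Context (R : realType) (dZ dF : measure_display)
  (Z : measurableType dZ) (F : measurableType dF)
  (l : F -> Z -> R) (fs : F) (n : nat) (eta : R) (P : probability Z R).
Context (ml : measurable_fun [set: F * Z] (fun x => l x.1 x.2)).

Local Notation r := (@excess_sum dZ dF Z F R l fs n).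
Local Notation C := (normalizer P l fs eta n).

Lemma measurable_excess_sum :
  measurable_fun [set: n.-tuple Z * F] (fun x => r x.2 x.1).
Proof.
apply: measurable_sum => i; apply: measurable_funB.
  apply: (measurableT_comp ml (g := fun x : n.-tuple Z * F => (x.2, tnth x.1 i))).
  apply/measurable_fun_pair => //.
  exact: (measurableT_comp (measurable_tnth i) measurable_fst).
apply: (measurableT_comp ml (g := fun x : n.-tuple Z * F => (fs, tnth x.1 i))).
apply/measurable_fun_pair => //.
exact: (measurableT_comp (measurable_tnth i) measurable_fst).
Qed.

Let measurable_expR_excess :
  measurable_fun [set: n.-tuple Z * F]
    (fun x => (expR (- eta * r x.2 x.1))%:E).
Proof.
apply/measurable_EFinP; apply: measurableT_comp => //.
by apply: measurable_funM => //; exact: measurable_excess_sum.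
Qed.

Lemma measurable_normalizer : measurable_fun [set: F] C.
Proof.
apply: (measurable_fun_fubini_tonelli_G (m1 := iid_law P n)
  (fun x : n.-tuple Z * F => (expR (- eta * r x.2 x.1))%:E)) => //.
Qed.

(** This excludes [lne (C f) = -oo]; the value [C f = +oo] remains possible. *)
Lemma normalizer_gt0 f : 0 < C f.
Proof.
apply: integral_gt0 => [|x]; last by rewrite lte_fin expR_gt0.
exact: (measurable_fun_pair1 f measurable_expR_excess).
Qed.

Lemma measurable_log_weight :
  measurable_fun [set: n.-tuple Z * F]
    (fun x => (eta * r x.2 x.1)%:E + lne (C x.2)).
Proof.
apply: emeasurable_funD.
  apply/measurable_EFinP/measurable_funM => //; exact: measurable_excess_sum.
apply: (measurableT_comp (@measurable_lne R)).
exact: (measurableT_comp measurable_normalizer measurable_snd).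
Qed.

(* The inner integral over the sample is 1, or 0 where [C f = +oo]. *)
Lemma integral_normalized_le1 (Pi : probability F R) :
  \int[iid_law P n]_zn \int[Pi]_f
    expeR (- ((eta * r f zn)%:E + lne (C f))) <= 1.
Proof.
have mu : measurable_fun [set: n.-tuple Z * F]
    (fun x => expeR (- ((eta * r x.2 x.1)%:E + lne (C x.2)))).
  apply: (measurableT_comp (@measurable_expeR R)).
  by apply: measurableT_comp => //; exact: measurable_log_weight.
rewrite (fubini_tonelli
  (fun x : n.-tuple Z * F => expeR (- ((eta * r x.2 x.1)%:E + lne (C x.2)))))//; last first.
  by move=> x; exact: expeR_ge0.
have C1 f : \int[iid_law P n]_zn
    expeR (- ((eta * r f zn)%:E + lne (C f))) <= 1.
  (* The excess term is finite, so the exponential splits, and the factor [expeR (- lne (C f))] does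
     not depend on the sample. *)
  under eq_integral do rewrite oppeD ?fin_num_adde_defr// expeRD -EFinN -mulNr /=.
  rewrite ge0_integralZr ?expeR_ge0//; last first.
    exact: (measurable_fun_pair1 f measurable_expR_excess).
  rewrite -/(C f); have := normalizer_gt0 f.
  case: (C f) => [c| |]//= c0; last by rewrite mule0.
  rewrite lte_fin in c0.
  by rewrite (leNgt c) c0/= expRN lnK ?posrE// -EFinM divff ?gt_eqF.
rewrite (@le_trans _ _ (\int[Pi]_f cst 1 f))//.
  apply: ge0_le_integral => //.
  - by move=> f _; apply: integral_ge0 => x _; exact: expeR_ge0.
  - by apply: (measurable_fun_fubini_tonelli_G (m1 := iid_law P n) _ mu) => x;
      exact: expeR_ge0.
  - by move=> f _; exact: C1.
by rewrite integral_cst//= probability_setT mule1.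
Qed.

End excess_risk.

(** * Divergence and the complexity bound *)

(** [KL] divides in [\bar R], the weight in [R]. Where [q > 0] the integrands agree, both being
    [+oo] if [p = 0]; the set where [q = 0] is [mu]-null. *)
Lemma KL_density_quotient d (T : measurableType d) (R : realType)
    (rho mu nu : {measure set T -> \bar R}) (q p : T -> R) :
  has_density rho mu q -> has_density rho nu p ->
  KL mu q p = \int[mu]_x - lne (p x / q x)%:E.
Proof.
move=> dq dp; have [mq q0 _] := dq; have [mp p0 _] := dp.
apply: ae_eq_integral => //.
- apply: (measurableT_comp (@measurable_lne R)).
  apply: emeasurable_funM; first exact/measurable_EFinP.
  under eq_fun do rewrite inver.
  apply: measurable_fun_ifT => //; first exact: measurable_fun_eqr.
  by apply/measurable_EFinP; exact: measurable_fun_invr_ge0.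
- apply: measurableT_comp => //; apply: (measurableT_comp (@measurable_lne R)).
  apply/measurable_EFinP/measurable_funM => //.
  exact: measurable_fun_invr_ge0.
- apply: filterS (has_density_zero_negligible dq) => x qx0 _.
  have qx : (0 < q x)%R by rewrite lt0r qx0 q0.
  rewrite inver; case: ifPn => [/eqP ->|px0].
    by rewrite mul0r gt0_muley ?lte_fin//= lexx.
  have px : (0 < p x)%R by rewrite lt0r px0 p0.
  by rewrite -EFinM -lneV ?divr_gt0// invf_div.
Qed.

(* In w, the quotient of real numbers has x / 0 = 0: this is the value of w on
   the Pihat-null set where the density of Pihat vanishes. *)
Theorem proposition1 (R : realType)
    (dZ : measure_display) (Z : measurableType dZ) (P : probability Z R)
    (dF : measure_display) (F : measurableType dF)
    (l : F -> Z -> R) (fs : F) (n : nat) (eta : R)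
    (rho : {measure set F -> \bar R}) (Pi : probability F R) (dens : F -> R)
    (Pihat : R.-pker (n.-tuple Z) ~> F) (dens_hat : n.-tuple Z -> F -> R) :
  measurable_fun [set: F * Z] (fun x => l x.1 x.2) ->
  risk_minimizer P l fs ->
  (1 <= n)%N ->
  (0 < eta)%R ->
  has_density rho Pi dens ->
  measurable_fun [set: n.-tuple Z * F] (fun x => dens_hat x.1 x.2) ->
  (forall zn, has_density rho (Pihat zn) (dens_hat zn)) ->
  let w := fun (zn : n.-tuple Z) (f : F) => (dens f / dens_hat zn f)%R in
  S_eta P l fs eta Pihat w <= 1 /\
  forall zn : n.-tuple Z,
    COMP_full P l fs eta Pihat w zn
    <= \int[Pihat zn]_f (excess_sum l fs f zn)%:E
       + (eta^-1)%:E * KL (Pihat zn) (dens_hat zn) dens.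
Proof.
move=> ml _ _ eta0 dPi mq dq w.
have [mp p0 _] := dPi.
have q0 zn f : (0 <= dens_hat zn f)%R by have [] := dq zn.
have w0 zn f : (0 <= w zn f)%R by rewrite divr_ge0.
have mw : measurable_fun [set: n.-tuple Z * F] (fun x => w x.1 x.2).
  apply: measurable_funM.
    exact: (measurableT_comp mp measurable_snd).
  exact: (@measurable_fun_invr_ge0 _ _ _
    (fun x : n.-tuple Z * F => dens_hat x.1 x.2)).
pose r := @excess_sum dZ dF Z F R l fs n.
pose C := normalizer P l fs eta n.
pose b (zn : n.-tuple Z) f := (eta * r f zn)%:E + lne (C f).
pose k (zn : n.-tuple Z) f := b zn f - lne (w zn f)%:E.
have mb : measurable_fun [set: n.-tuple Z * F] (fun x => b x.1 x.2).
  exact: measurable_log_weight.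
have mk : measurable_fun [set: n.-tuple Z * F] (fun x => k x.1 x.2).
  apply: emeasurable_funB => //.
  by apply: (measurableT_comp (@measurable_lne R)); exact/measurable_EFinP.
have mk2 zn : measurable_fun [set: F] (k zn).
  exact: (measurable_fun_pair2 zn mk).
have mu : measurable_fun [set: n.-tuple Z * F] (fun x => expeR (- b x.1 x.2)).
  apply: (measurableT_comp (@measurable_expeR R)).
  exact: measurableT_comp.
have mek zn : measurable_fun [set: F] (fun f => expeR (- k zn f)).
  apply: (measurableT_comp (@measurable_expeR R)).
  exact: measurableT_comp.
(* The splitting must avoid oo - oo: [lne (w zn f)%:E] is never [+oo] since [w] is real-valued, and
   [b] is never [-oo] since [C f > 0]. *)
have kE zn f : expeR (- k zn f) = expeR (- b zn f) * (w zn f)%:E.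
  have lwoo : lne (w zn f)%:E != +oo by rewrite /=; case: ifP.
  have bNoo : b zn f != -oo.
    by rewrite /b; have := normalizer_gt0 fs n eta P ml f; rewrite -/(C f);
      case: (C f) => [c| |]//=; rewrite lte_fin leNgt => ->.
  rewrite /k oppeB; first by rewrite expeRD expeR_lneK_EFin.
  by move: lwoo bNoo; case: (lne _) => [?| |]; case: (b zn f).
have S1 : S_eta P l fs eta Pihat w <= 1.
  apply: le_trans (integral_normalized_le1 fs n eta P ml Pi).
  apply: ge0_le_integral => //.
  - by move=> zn _; exact: expeR_ge0.
  - apply: (measurableT_comp (@measurable_expeR R)).
    apply: measurableT_comp => //.
    (* As [k] is signed, measurability in [zn] comes from the kernel integrals of its positive and
       negative parts. *)
    rewrite (_ : (fun zn => _) = fun zn =>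
      \int[Pihat zn]_f (fun x => k x.1 x.2)^\+ (zn, f) -
      \int[Pihat zn]_f (fun x => k x.1 x.2)^\- (zn, f)); last first.
      by apply/funext => zn; rewrite integralE; congr (_ - _);
        apply: eq_integral => f _; rewrite ?funeposE ?funenegE.
    apply: emeasurable_funB; apply: measurable_fun_integral_finite_kernel => //.
      exact: measurable_funepos.
    exact: measurable_funeneg.
  - by apply: (measurable_fun_fubini_tonelli_F (m2 := Pi) _ mu) => x;
      exact: expeR_ge0.
  (* After Jensen both sides become integrals against [rho], where the integrands are compared
     pointwise. *)
  move=> zn _; apply: le_trans (expeR_integral_le (prob_kernel zn) (mk2 zn)) _.
  rewrite (has_density_ge0_integral (dq zn))//; last first.
    by move=> f; exact: expeR_ge0.
  rewrite (has_density_ge0_integral dPi); last 2 first.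
  - exact: (measurable_fun_pair2 zn mu).
  - by move=> f; exact: expeR_ge0.
  have [mqz _ _] := dq zn.
  apply: ge0_le_integral => //.
  - by move=> f _; rewrite mule_ge0 ?lee_fin ?expeR_ge0.
  - by apply: emeasurable_funM => //; exact/measurable_EFinP.
  - apply: emeasurable_funM; first exact/measurable_EFinP.
    exact: (measurable_fun_pair2 zn mu).
  move=> f _; rewrite kE muleCA muleC lee_wpmul2r ?expeR_ge0// -EFinM lee_fin.
  (* Equality holds where [dens_hat] is nonzero. Where it vanishes the left side is 0, and the mass
     that [Pi] may have there is lost. *)
  have [q00|q00] := eqVneq (dens_hat zn f) 0%R; first by rewrite q00 mul0r.
  by rewrite /w mulrCA divff// mulr1.
(* The expected excess, possibly infinite, is added to both sides by monotonicity and never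
   cancelled. *)
split=> // zn; rewrite /COMP_full [leRHS]addeC leeD2r// /COMP.
apply: lee_wpmul2l; first by rewrite lee_fin invr_ge0 ltW.
by rewrite (KL_density_quotient (dq zn) dPi) -[leRHS]adde0 leeD2l ?lne_le0.
Qed.
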